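(* Let $s_m^{(0)}\in\mathcal{X}$ for $m=1,\ldots,M$. Let $\tau>0$, let $\omega_1>0,\ldots,\omega_M>0$ be reals whose sum is $1$, and let $(\rho^{(i)})_{i\in\mathbb{N}}$ be a sequence in $[0,2]$ such that $\sum_{i\in\mathbb{N}}\rho^{(i)}(2-\rho^{(i)})=+\infty$. Let the sequence $(x^{(i+\frac12)})_{i\in\mathbb{N}}$ be defined, for $i=0,1,\ldots$, either by (form I) $$\begin{aligned}x^{(i+\frac12)}&=\mathrm{prox}_{\tau f}\Big(\sum_{m=1}^M\omega_m s_m^{(i)}\Big),\\ s_m^{(i+1)}&=s_m^{(i)}+\rho^{(i)}\Big(\mathrm{prox}_{\frac{\tau}{\omega_m}g_m}\big(2x^{(i+\frac12)}-s_m^{(i)}\big)-x^{(i+\frac12)}\Big),\quad m=1,\ldots,M,\end{aligned}$$ or by (form II) $$\begin{aligned}x_m^{(i+\frac12)}&=\mathrm{prox}_{\frac{\tau}{\omega_m}g_m}\big(s_m^{(i)}\big),\quad m=1,\ldots,M,\\ x^{(i+\frac12)}&=\mathrm{prox}_{\tau f}\Big(\sum_{m=1}^M\omega_m\big(2x_m^{(i+\frac12)}-s_m^{(i)}\big)\Big),\\ s_m^{(i+1)}&=s_m^{(i)}+\rho^{(i)}\big(x^{(i+\frac12)}-x_m^{(i+\frac12)}\big),\quad m=1,\ldots,M.\end{aligned}$$ Then, in either case, $(x^{(i+\frac12)})_{i\in\mathbb{N}}$ converges weakly to a solution of the problem of minimizing $f(x)+\sum_{m=1}^M g_m(x)$ over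 $x\in\mathcal{X}$.
   Context: $M\ge 1$ is an integer and $\mathcal{X}$ is a real Hilbert space. $\Gamma_0(\mathcal{X})$ is the set of convex, proper, lower semicontinuous functions from $\mathcal{X}$ to $\mathbb{R}\cup\{+\infty\}$, and for $\varphi\in\Gamma_0(\mathcal{X})$, $\mathrm{prox}_{\varphi}(x)=\operatorname{arg\,min}_{x'\in\mathcal{X}}(\varphi(x')+\frac12\|x'-x\|^2)$, $\partial\varphi$ is the subdifferential. Here $f\in\Gamma_0(\mathcal{X})$ and $g_m\in\Gamma_0(\mathcal{X})$ for $m=1,\ldots,M$. Standing assumption: there exists $x\in\mathcal{X}$ with $0\in\partial f(x)+\sum_{m=1}^M\partial g_m(x)$. *)

(* Defs.v *)
From HB Require Import structures.
From mathcomp Require Import all_boot all_order all_algebra.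
From mathcomp Require Import all_classical all_reals all_analysis.
From mathcomp Require Export sesquilinear.

Set Implicit Arguments.
Unset Strict Implicit.
Unset Printing Implicit Defensive.

Import Order.TTheory GRing.Theory Num.Theory.
Import numFieldNormedType.Exports.

Local Open Scope classical_set_scope.
Local Open Scope ring_scope.

Section ConvexAnalysis.
Context {R : realType} {X : completeNormedModType R}.
Implicit Types (phi : X -> \bar R) (x y p : X).
Local Open Scope ereal_scope.

(* In \bar R, 0 * +oo = 0, so the endpoints t = 0 and t = 1 add nothing. *)
Definition convex_ereal phi : Prop :=
  forall x y (t : R), (0 <= t <= 1)%R ->
    phi (t *: x + (1 - t) *: y)%R <= t%:E * phi x + (1 - t)%:E * phi y.

Definition proper_ereal phi : Prop :=
  (forall x, phi x != -oo) /\ (exists x, phi x < +oo).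

Definition Gamma0 : set (X -> \bar R) :=
  [set phi | [/\ convex_ereal phi, proper_ereal phi
                & lower_semicontinuous phi]].

Definition argmin phi : set X := [set p | forall y, phi p <= phi y].

(* For phi in Gamma0 the argmin below is a singleton; the default value 0 is
   returned only when it is empty. *)
Definition prox phi x : X :=
  xget 0%R (argmin (fun y => phi y + (2^-1 * `|y - x| ^+ 2)%:E)).

Definition subdifferential (dot : {dot X for idfun}) phi x : set X :=
  [set u | forall y, phi x + (dot (y - x)%R u)%:E <= phi y].

(* By the Riesz representation theorem, the maps dot ^~ y are exactly the
   continuous linear functionals. *)
Definition weakly_cvg_to (dot : {dot X for idfun}) (u : nat -> X) (l : X) :
    Prop :=
  forall y, (fun n => dot (u n) y) @ \oo --> (dot l y : R).

End ConvexAnalysis.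

Section Algorithms.
Context {R : realType} {X : completeNormedModType R} {M : nat}.
Variables (f : X -> \bar R) (g : 'I_M -> X -> \bar R).
Variables (tau : R) (omega : 'I_M -> R) (rho : nat -> R).

Let proxf : X -> X := prox (fun y => tau%:E * f y)%E.
Let proxg (m : 'I_M) : X -> X :=
  prox (fun y => (tau / omega m)%:E * g m y)%E.

(* Half-integer iterates are shifted: [x i] stands for x^(i + 1/2), and
   [xm i m] for x_m^(i + 1/2). *)
Definition form_I (s : nat -> 'I_M -> X) (x : nat -> X) : Prop :=
  forall i,
    x i = proxf (\sum_(m < M) omega m *: s i m) /\
    (forall m, s i.+1 m =
       s i m + rho i *: (proxg m (2 *: x i - s i m) - x i)).

Definition form_II (s xm : nat -> 'I_M -> X) (x : nat -> X) : Prop :=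
  forall i,
    [/\ forall m, xm i m = proxg m (s i m),
        x i = proxf (\sum_(m < M) omega m *: (2 *: xm i m - s i m))
      & forall m, s i.+1 m = s i m + rho i *: (x i - xm i m)].

End Algorithms.

(* Main.v *)
Require Import Defs.
From HB Require Import structures.
From mathcomp Require Import all_boot all_order all_algebra.
From mathcomp Require Import all_classical all_reals all_analysis.
From mathcomp Require Import ring lra.

Import Order.TTheory GRing.Theory Num.Theory.
Import numFieldNormedType.Exports.

Local Open Scope classical_set_scope.
Local Open Scope ring_scope.

(**
Let [A] be the subdifferential of [tau * f] and [B m] that of
[(tau / omega m) * g m]; a proximity operator is the resolvent of such a
subdifferential. On families of [M] vectors with the inner product weighted by
[omega], both forms are relaxed Douglas-Rachford iterations for the diagonal
operator built from [A] and the separable operator built from the [B m]; they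
only differ in which of the two resolvents is evaluated first.

The order of evaluation is absorbed in a sign [eps]. With [z m] in the domain
of [B m] and the residual [r m = eps * (z m - x)], one iteration reads
[s m = x - r m - eps * b m] with [b m] in [B m (x + eps * r m)], [a] in [A x]
and [a + sum omega m * (b m + r m) = 0], followed by [s + rho * r]. This is the
relation [dr_step], with [eps = 1] for form I and [eps = -1] for form II. When
[r = 0] it says that [x] solves the monotone inclusion, hence the minimization
problem ([argmin_sum]).

Monotonicity makes [s |-> - r] firmly nonexpansive ([dr_step_firm]). Two
consequences follow, as for any Krasnoselskii-Mann iteration: the distance of
the iterates to each fixed point decreases ([fejer]), by an amount controlled by
[rho * (2 - rho)] times the squared residual, and the residuals decrease too
([residual_nonincreasing]). Divergence of the sum of [rho * (2 - rho)] then
forces the residuals to tend to zero ([residual_cvg0]).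

Weak limits are taken along ultrafilters: a bounded sequence in a Hilbert space
has a weak limit along each of them ([ultra_weak_limit]). Such a limit of the
pair [(s, x)] is a fixed pair ([dr_step_demiclosed]). The proof uses that the
operators are maximal monotone, in Minty's form: [id + A] and [id + B m] are
onto. By Opial's argument the limit does not depend on the ultrafilter
([opial_unique]), and [x] is determined by [s] and [r] ([dr_step_lipschitz]);
a sequence with the same limit along all ultrafilters converges ([ultra_cvg]).

The existence of proximal points in a Hilbert space, the only place where
completeness enters, also yields the Riesz representation needed for the weak
limits: the vector representing a bounded linear form [L] is the proximal point
of [- L] at the origin.
*)

(** * Inner product identities *)

Section HilbertSpace.
Context {R : realType} {X : completeNormedModType R}.
Context (dot : {dot X for idfun}).
Context (dot_norm : forall x : X, dot x x = `|x| ^+ 2).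
Implicit Types (u v w x y z p : X) (phi : X -> \bar R).

Lemma dotC u v : dot u v = dot v u.
Proof. by rewrite [LHS](@hermC _ _ idfun) /= expr0 mul1r. Qed.

Lemma dotDl u v w : dot (u + v) w = dot u w + dot v w.
Proof. exact: linearDl. Qed.

Lemma dotDr u v w : dot w (u + v) = dot w u + dot w v.
Proof. exact: linearDr. Qed.

Lemma dotNl u w : dot (- u) w = - dot u w.
Proof. exact: linearNl. Qed.

Lemma dotNr u w : dot w (- u) = - dot w u.
Proof. exact: linearNr. Qed.

Lemma dotZl a u w : dot (a *: u) w = a * dot u w.
Proof. exact: linearZl_LR. Qed.

Lemma dotZr a u w : dot w (a *: u) = a * dot w u.
Proof. by rewrite dotC dotZl dotC. Qed.

Lemma dot0l w : dot 0 w = 0.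
Proof. exact: linear0l. Qed.

Lemma dot0r w : dot w 0 = 0.
Proof. exact: linear0r. Qed.

Lemma dot_sumr (I : finType) (F : I -> X) w :
  dot w (\sum_i F i) = \sum_i dot w (F i).
Proof. exact: linear_sumr. Qed.

Definition dotE := (dotDl, dotDr, dotNl, dotNr, dotZl, dotZr, dot0l, dot0r).

Lemma sqr_normD u v : `|u + v| ^+ 2 = `|u| ^+ 2 + 2 * dot u v + `|v| ^+ 2.
Proof. by rewrite -!dot_norm !dotE (dotC v u); ring. Qed.

Lemma sqr_normB u v : `|u - v| ^+ 2 = `|u| ^+ 2 - 2 * dot u v + `|v| ^+ 2.
Proof. by rewrite -!dot_norm !dotE (dotC v u); ring. Qed.

Lemma dot_le_norm u v : dot u v <= `|u| * `|v|.
Proof.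
have [->|u0] := eqVneq u 0; first by rewrite dot0l normr0 mul0r.
have [->|v0] := eqVneq v 0; first by rewrite dot0r normr0 mulr0.
have nu : 0 < `|u| by rewrite normr_gt0.
have nv : 0 < `|v| by rewrite normr_gt0.
have : 0 <= `| `|v| *: u - `|u| *: v| ^+ 2 by rewrite sqr_ge0.
rewrite sqr_normB !normrZ !normr_id !dotE.
rewrite (_ : _ + _ = (2 * (`|u| * `|v|)) * (`|u| * `|v| - dot u v)); last first.
  by ring.
by rewrite pmulr_rge0 ?subr_ge0// !mulr_gt0.
Qed.

Lemma normr_dot_le u v : `|dot u v| <= `|u| * `|v|.
Proof.
rewrite ler_norml dot_le_norm andbT lerNl -dotNl.
by rewrite -[X in _ <= X * _]normrN dot_le_norm.
Qed.

(** Testing against an inner product turns an identity between linear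
combinations of vectors into an identity between reals, which [ring] proves. *)
Lemma dot_inj u v : (forall w, dot u w = dot v w) -> u = v.
Proof.
move=> uv; apply/eqP; rewrite -subr_eq0 -normr_eq0 -sqrf_eq0 -dot_norm.
by rewrite dotDl dotNl uv subrr.
Qed.

Lemma le_norm_dot u v : 0 <= dot u (v - u) -> `|u| <= `|v|.
Proof.
rewrite !dotE dot_norm => le_uv.
have := dot_le_norm u v; have := normr_ge0 u; have := normr_ge0 v; nra.
Qed.

(** * Proximal points *)

Lemma convex_combE (t : R) y z : t *: y + (1 - t) *: z = z + t *: (y - z).
Proof. by rewrite scalerBl scale1r scalerBr addrCA. Qed.

Lemma proper_EFin phi y : proper_ereal phi -> (phi y < +oo)%E ->
  exists c, phi y = c%:E.
Proof.
by move=> [/(_ y)]; case: (phi y) => // r _ _ _; exists r.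
Qed.

Lemma convex_EFin phi y z (a b t : R) : convex_ereal phi -> proper_ereal phi ->
  phi y = a%:E -> phi z = b%:E -> 0 <= t <= 1 ->
  exists2 c, phi (t *: y + (1 - t) *: z) = c%:E & c <= t * a + (1 - t) * b.
Proof.
move=> cvx prp ya zb /(cvx y z); rewrite ya zb -!EFinM -EFinD => le_t.
have [|c cE] := proper_EFin _ (t *: y + (1 - t) *: z) prp.
  by rewrite (le_lt_trans le_t)// ltry.
by exists c => //; rewrite -lee_fin -cE.
Qed.

(** Lower semicontinuity bounds [phi] below by [phi x0 - 1] near a point [x0] of
its domain, say on a ball of radius [r]. A point at distance [n] from [x0] is
pulled into that ball by a convex combination of weight about [r / n], and
convexity carries the bound back, divided by that weight. *)
Lemma Gamma0_minorant phi : Gamma0 phi ->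
  exists a b : R, forall y c, phi y = c%:E -> a - b * `|y| <= c.
Proof.
move=> [cvx prp lsc].
have [x0 /(proper_EFin _ _ prp)[c0 x0c]] := prp.2.
have [|V /nbhs_ballP[r /= r0 rV] Vlt] := lsc x0 (c0 - 1).
  by rewrite x0c lte_fin gtrBl.
exists (c0 - 2 - 2 / r * `|x0|), (2 / r) => y c yc.
pose n := `|y - x0|.
have n0 : 0 <= n by rewrite normr_ge0.
(* This weight is at most 1, and moves y to within distance r of x0. *)
pose t := r / (2 * (n + r)).
have d0 : 0 < 2 * (n + r) by lra.
have t0 : 0 < t by rewrite divr_gt0.
have tE : t * (2 * (n + r)) = r by rewrite divfK// gt_eqF.
have t1 : t <= 1 by rewrite ler_pdivrMr// mul1r; lra.
have [|c' c'E c'le] := convex_EFin _ _ _ _ _ t cvx prp yc x0c; first lra.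
have : ((c0 - 1)%:E < phi (t *: y + (1 - t) *: x0)%R)%E.
  apply/Vlt/rV; rewrite -ball_normE /=.
  rewrite convex_combE opprD addNKr.
  by rewrite normrN normrZ gtr0_norm// -/n; nra.
rewrite c'E lte_fin => lt_c'.
have ny : n <= `|y| + `|x0| by rewrite ler_normB.
have -> : c0 - 2 - 2 / r * `|x0| - 2 / r * `|y|
    = c0 - 2 - 2 * (`|y| + `|x0|) / r.
  by field; rewrite gt_eqF.
have tV : t^-1 = 2 * n / r + 2 by rewrite /t; field; rewrite !gt_eqF//; lra.
have : - 1 < t * (c - c0) by lra.
rewrite -ltr_pdivrMl// tV mulrN1 => lt_c.
have : 2 * n / r <= 2 * (`|y| + `|x0|) / r by rewrite ler_pM2r ?invr_gt0//; lra.
lra.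
Qed.

(** The minorant makes the objective bounded below. By the parallelogram
identity and convexity, its sublevel sets at height [I + e] over the infimum [I]
have diameter at most [sqrt (8 * e)], so they generate a Cauchy filter; lower
semicontinuity at the limit of that filter shows that the infimum is attained. *)
Lemma prox_exists phi x : Gamma0 phi ->
  argmin (fun y => phi y + (2^-1 * `|y - x| ^+ 2)%:E)%E !=set0.
Proof.
move=> Gphi; have [a [b minor]] := Gamma0_minorant _ Gphi.
have [cvx prp lsc] := Gphi.
pose q y : R := 2^-1 * `|y - x| ^+ 2.
pose vals := [set r | exists y c, phi y = c%:E /\ r = c + q y].
have has_inf_vals : has_inf vals.
  split.
    have [y /(proper_EFin _ _ prp)[c yc]] := prp.2.
    by exists (c + q y), y, c.
  exists (a - `|b| * `|x| - 2^-1 * `|b| ^+ 2) => _ [y [c [yc ->]]].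
  have := minor _ _ yc; have := ler_norm b; have := normr_ge0 b.
  have : `|y| <= `|y - x| + `|x| by rewrite -{1}(subrK x y) ler_normD.
  rewrite /q; move: (normr_ge0 y) (normr_ge0 x); move: `|y - x| => n.
  have : 0 <= (n - `|b|) ^+ 2 by rewrite sqr_ge0.
  by nra.
pose I := inf vals.
have I_le y c : phi y = c%:E -> I <= c + q y.
  by move=> yc; apply: ge_inf; [case: has_inf_vals | exists y, c].
pose S e := [set y | exists2 c, phi y = c%:E & c + q y <= I + e].
have S_mono e e' : e <= e' -> S e `<=` S e'.
  by move=> ee' y [c yc le_c]; exists c => //; lra.
have S_ex e : 0 < e -> S e !=set0.
  move=> e0; have [_ [y [c [yc ->]]] lt_c] := inf_adherent e0 has_inf_vals.
  by exists y, c => //; exact: ltW.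
have S_diam e y z : S e y -> S e z -> `|y - z| ^+ 2 <= 8 * e.
  move=> [c yc cle] [d zd dle].
  have [|m mE mle] := convex_EFin _ _ _ _ _ 2^-1 cvx prp yc zd; first lra.
  have := I_le _ _ mE; rewrite /q.
  have -> : 2^-1 *: y + (1 - 2^-1) *: z - x = 2^-1 *: ((y - x) + (z - x)).
    rewrite (_ : 1 - 2^-1 = 2^-1 :> R); last by field.
    rewrite -scalerDr addrACA [RHS]scalerDr; congr (_ + _).
    rewrite -opprD scalerN scalerDr -scalerDl (_ : _ + _ = 1) ?scale1r//.
    by field.
  have -> : y - z = (y - x) - (z - x) by rewrite opprB addrA subrK.
  rewrite normrZ exprMn (sqr_normB (y - x)) (sqr_normD (y - x)).
  rewrite ger0_norm ?invr_ge0//.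
  move: cle dle mle; rewrite /q. lra.
pose F := filter_from [set e : R | 0 < e] S.
have FF : ProperFilter F.
  apply: filter_from_proper; last by move=> e; exact: S_ex.
  apply: filter_from_filter; first by exists 1 => /=.
  move=> e e' /= e0 e'0; exists (Num.min e e'); first by rewrite /= lt_min e0.
  by move=> y Sy; split; apply: S_mono Sy; rewrite ge_min lexx ?orbT.
have /cauchy_cvgP/cvg_ex[p Fp] : cauchy F.
  apply: cauchy_exP => e e0.
  have e80 : 0 < e ^+ 2 / 16 by rewrite divr_gt0// exprn_gt0.
  have [y Sy] := S_ex _ e80.
  exists y, (e ^+ 2 / 16) => // z Sz; rewrite -ball_normE /=.
  rewrite -(@ltr_pXn2r _ 2) ?nnegrE ?normr_ge0 ?(ltW e0)//.
  by rewrite (le_lt_trans (S_diam _ _ _ Sy Sz))//; lra.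
have q_cvg : q @ p --> q p.
  apply: cvgM; first exact: cvg_cst.
  apply: (@continuous_comp _ _ _ (fun y => `|y - x|) (fun r => r ^+ 2)).
    by apply: cvg_norm; apply: cvgB; [exact: cvg_id | exact: cvg_cst].
  exact: exprn_continuous.
have p_le : (phi p + (q p)%:E <= I%:E)%E.
  apply/lee_addgt0Pr => e e0; rewrite -EFinD leNgt; apply/negP => lt_p.
  have e20 : 0 < e / 2 by rewrite divr_gt0.
  have /lsc[V pV Vlt] : ((I + e - q p)%:E < phi p)%E by rewrite EFinB lteBlDr.
  have [y [[Vy qy] [c yc cle]]] :
      (V `&` [set y | q p - e / 2 < q y] `&` S (e / 2)) !=set0.
    apply: (@filter_ex _ F); apply: filterI; last by exists (e / 2).
    by apply: Fp; apply: filterI => //; apply: (cvgr_gt _ q_cvg); lra.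
  by have := Vlt _ Vy; rewrite yc lte_fin; move: qy cle => /=; lra.
exists p => y /=; apply: (le_trans p_le).
have [ltoo|] := boolP (phi y < +oo)%E; last first.
  by rewrite -leNgt leye_eq => /eqP ->; rewrite addye ?leey.
have [c yc] := proper_EFin _ _ prp ltoo.
by rewrite yc -EFinD lee_fin I_le.
Qed.

(** Compare the minimizer [p] with points on the segment towards [y]: the
quadratic term only changes to second order beyond its differential, so a
violation [del] of the subgradient inequality is impossible for a small step. *)
Lemma argmin_subdifferential phi x p : convex_ereal phi -> proper_ereal phi ->
  argmin (fun y => phi y + (2^-1 * `|y - x| ^+ 2)%:E)%E p ->
  subdifferential dot phi p (x - p).
Proof.
move=> cvx prp minp.
have [y0 /(proper_EFin _ _ prp)[c0 y0c]] := prp.2.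
have [|c pc] := proper_EFin _ p prp.
  rewrite ltey; apply/eqP => poo.
  by have := minp y0; rewrite poo y0c addye// -EFinD leye_eq.
move=> y; have [ltoo|] := boolP (phi y < +oo)%E; last first.
  by rewrite -leNgt leye_eq => /eqP ->; rewrite leey.
have [d yd] := proper_EFin _ _ prp ltoo.
rewrite pc yd -EFinD lee_fin leNgt; apply/negP => lt_d.
pose N := `|y - p| ^+ 2.
have N0 : 0 <= N by rewrite sqr_ge0.
pose del := c + dot (y - p) (x - p) - d.
have del0 : 0 < del by rewrite subr_gt0.
(* The comparison gives del <= t * N / 2, which this step contradicts. *)
pose t := del / (del + N).
have t0 : 0 < t by rewrite divr_gt0// ltr_wpDr.
have tE : t * (del + N) = del by rewrite divfK// gt_eqF// ltr_wpDr.
have t1 : t <= 1 by rewrite ler_pdivrMr ?mul1r ?lerDl// ltr_wpDr.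
have [|e eE ele] := convex_EFin _ _ _ _ _ t cvx prp yd pc; first lra.
have := minp (t *: y + (1 - t) *: p); rewrite pc eE -!EFinD lee_fin.
have -> : t *: y + (1 - t) *: p - x = t *: (y - p) - (x - p).
  by rewrite convex_combE opprB (addrC p) addrA.
rewrite (sqr_normB (t *: _)) normrZ exprMn (gtr0_norm t0) dotZl -/N.
rewrite (distrC p) => le_e.
have : del <= t * N / 2 by rewrite -(ler_pM2l t0) /del; nra.
by nra.
Qed.

Lemma prox_subdifferential phi x : Gamma0 phi ->
  subdifferential dot phi (prox phi x) (x - prox phi x).
Proof.
move=> Gphi; have [cvx prp _] := Gphi.
apply: argmin_subdifferential => //.
have [p minp] := prox_exists _ x Gphi.
exact: xgetI minp.
Qed.

(** * Subdifferentials *)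

Lemma subdifferential_EFin phi x u : proper_ereal phi ->
  subdifferential dot phi x u -> exists c, phi x = c%:E.
Proof.
move=> prp sub; have [y0 /(proper_EFin _ _ prp)[c0 y0c]] := prp.2.
apply: proper_EFin => //; rewrite ltey; apply/eqP => poo.
by have := sub y0; rewrite poo y0c addye// leye_eq.
Qed.

Lemma subdifferential_monotone phi x y u v : proper_ereal phi ->
  subdifferential dot phi x u -> subdifferential dot phi y v ->
  0 <= dot (x - y) (u - v).
Proof.
move=> prp xu yv.
have [c xc] := subdifferential_EFin _ _ _ prp xu.
have [d yd] := subdifferential_EFin _ _ _ prp yv.
have := xu y; have := yv x; rewrite xc yd -!EFinD !lee_fin !dotE; lra.
Qed.

Lemma Gamma0_scale phi (c : R) : 0 < c -> Gamma0 phi ->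
  Gamma0 (fun y => c%:E * phi y)%E.
Proof.
move=> c0 [cvx [nNoo [y0 y0oo]] lsc]; split.
- have gtNy t z : 0 <= t -> (-oo < t%:E * phi z)%E.
    rewrite le_eqVlt => /predU1P[<-|t0]; first by rewrite mul0e ltNyr.
    have := nNoo z; case: (phi z) => [r| |]//; rewrite ?gt0_muley ?lte_fin//.
    by rewrite ltNyr.
  move=> x y t /andP[t0 t1].
  rewrite (muleCA t%:E) (muleCA (1 - t)%:E) -muleDr//; last first.
    by apply: ltninfty_adde_def; rewrite inE; apply: gtNy; rewrite ?subr_ge0.
  by rewrite lee_pmul2l ?lte_fin//; apply: cvx; rewrite t0.
- split=> [x|]; last first.
    exists y0; have [//|d ->] := proper_EFin phi y0 _ y0oo.
      by split=> //; exists y0.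
    by rewrite -EFinM ltry.
  by have := nNoo x; case: (phi x) => [r| |]//; rewrite gt0_muley ?lte_fin.
- move=> x a; rewrite -lte_pdivrMl// => /lsc[V xV Vlt]; exists V => // y.
  by move=> /Vlt; rewrite EFinM lte_pdivrMl.
Qed.

Lemma subdifferential_scale phi (c : R) x u : 0 < c ->
  subdifferential dot (fun y => c%:E * phi y)%E x (c *: u) <->
  subdifferential dot phi x u.
Proof.
move=> c0.
have scaleE y : ((phi x + (dot (y - x) u)%:E <= phi y) =
    (c%:E * phi x + (dot (y - x) (c *: u))%:E <= c%:E * phi y))%E.
  rewrite -[LHS](@lee_pmul2l _ c%:E) ?lte_fin//.
  by rewrite muleDr ?fin_num_adde_defl// -EFinM dotZr.
by split=> sub y; move: (sub y); rewrite scaleE.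
Qed.

Lemma argmin_sum {I : finType} (f : X -> \bar R) (g : I -> X -> \bar R) x u
    (v : I -> X) :
  proper_ereal f -> (forall m, proper_ereal (g m)) ->
  subdifferential dot f x u -> (forall m, subdifferential dot (g m) x (v m)) ->
  u + \sum_m v m = 0 ->
  argmin (fun y => f y + \sum_m g m y)%E x.
Proof.
move=> fP gP fu gv uv0 y.
have [c fc] := subdifferential_EFin _ _ _ fP fu.
have /choice[d gd] : forall m, exists d, g m x = d%:E.
  by move=> m; exact: subdifferential_EFin (gv m).
have -> : (f x + \sum_m g m x =
    (f x + (dot (y - x) u)%:E) + \sum_m (g m x + (dot (y - x) (v m))%:E))%E.
  under eq_bigr do rewrite gd.
  under [in RHS]eq_bigr do rewrite gd -EFinD.
  rewrite !sumEFin fc -!EFinD; congr EFin.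
  rewrite big_split/= -dot_sumr addrACA -dotDr uv0.
  by rewrite dot0r addr0.
by apply: leeD; [exact: fu | apply: lee_sum => m _; exact: gv].
Qed.

(** * Weak limits along ultrafilters *)

(** The optimality condition of the proximal point [p] of [- L] at the origin
reads [L h <= dot p h] for all [h]; applied to [- h], it becomes an equality. *)
Lemma riesz (L : X -> R) (B : R) :
  (forall a u v, L (a *: u + v) = a * L u + L v) ->
  (forall y, `|L y| <= B * `|y|) -> exists l, forall y, L y = dot l y.
Proof.
move=> Llin LB.
have LD u v : L (u + v) = L u + L v by rewrite -[u]scale1r Llin mul1r scale1r.
have L0 : L 0 = 0 by have := LD 0 0; rewrite addr0; lra.
have LZ a u : L (a *: u) = a * L u by rewrite -[a *: u]addr0 Llin L0 addr0.
have LN u : L (- u) = - L u by rewrite -scaleN1r LZ mulN1r.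
have G : Gamma0 (fun y => (- L y)%:E).
  split.
  - by move=> x y t _; rewrite -!EFinM -EFinD lee_fin Llin LZ; lra.
  - by split=> //; exists 0; rewrite ltry.
  - move=> x a; rewrite lte_fin => lt_a.
    pose r := (- L x - a) / (`|B| + 1).
    have B1 : 0 < `|B| + 1 by rewrite ltr_wpDl.
    have r0 : 0 < r by rewrite divr_gt0// subr_gt0.
    have rE : r * (`|B| + 1) = - L x - a by rewrite divfK// gt_eqF.
    exists (ball x r); first exact: nbhsx_ballx.
    move=> y; rewrite -ball_normE /= distrC => yr; rewrite lte_fin.
    have := LB (y - x); rewrite LD LN ler_norml => /andP[_].
    have := ler_norm B; have := normr_ge0 (y - x); nra.
pose p := prox (fun y => (- L y)%:E) 0.
have Lle h : L h <= dot p h.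
  have := prox_subdifferential _ 0 G (p + h); rewrite -/p.
  by rewrite -EFinD lee_fin LD !dotE (dotC h); lra.
exists p => y; apply/eqP; rewrite eq_le Lle /=.
by have := Lle (- y); rewrite LN dotNr; lra.
Qed.

Lemma ultra_bounded_cvg {T : Type} (U : set_system T) (h : T -> R) (B : R) :
  UltraFilter U -> (forall i, `|h i| <= B) -> exists l : R, h @ U --> l.
Proof.
move=> UU hB.
have [|l [_ lcl]] := @segment_compact R (- B) B (h @ U) _.
  by apply: (@filterE _ U) => i; rewrite /= in_itv /= -ler_norml.
exists l => A Al; have [//|nA] := in_ultra_setVsetC (h @^-1` A) UU.
have [r [] //] : (~` A) `&` A !=set0 by apply: lcl.
Qed.

(** If some preimage of a neighborhood of [l] is not in [F], its complement and
[F] lie in a common ultrafilter, along which [h] cannot tend to [l]. *)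
Lemma ultra_cvg {T : Type} {Y : topologicalType} (F : set_system T)
    (h : T -> Y) (l : Y) : ProperFilter F ->
  (forall U : set_system T, UltraFilter U -> F `<=` U -> h @ U --> l) ->
  h @ F --> l.
Proof.
move=> FF ultra A Al; apply: contrapT => nFA.
have FW : ProperFilter (within (~` (h @^-1` A)) F).
  split; last exact: within_filter.
  move=> FA; apply: nFA; apply: (@filterS _ F _ _ _ _ FA) => t /= nA.
  exact: contrapT.
have [U [UU WU]] := ultraFilterLemma FW.
have UA : U (h @^-1` A).
  by apply: ultra => // B FB; apply: WU; apply: filterS FB.
have UnA : U (~` (h @^-1` A)) by apply: WU; apply: (@filterE _ F).
by have [t [At nAt]] := filter_ex (filterI UA UnA); exact: nAt At.
Qed.

(** Weak sequential compactness in ultrafilter form: the coordinatewise limits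
define a bounded linear form, which is represented by a vector. *)
Lemma ultra_weak_limit {T : Type} (U : set_system T) (u : T -> X) (B : R) :
  UltraFilter U -> (forall i, `|u i| <= B) ->
  exists l, forall y, dot (u i) y @[i --> U] --> dot l y.
Proof.
move=> UU uB.
have /choice[L Lcvg] : forall y, exists l : R, dot (u i) y @[i --> U] --> l.
  move=> y; apply: (@ultra_bounded_cvg _ _ _ (B * `|y|)) => i.
  by rewrite (le_trans (normr_dot_le _ _))// ler_wpM2r.
have [a v w|y|l lE] := riesz L B.
- have Lsum : a * dot (u i) v + dot (u i) w @[i --> U] --> a * L v + L w.
    by apply: cvgD; [apply: cvgM; [exact: cvg_cst | exact: Lcvg] | exact: Lcvg].
  apply: (cvg_unique _ (Lcvg (a *: v + w))) => //.
  rewrite (_ : (fun i => dot (u i) (a *: v + w)) =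
               (fun i => a * dot (u i) v + dot (u i) w))//.
  by apply/funext => i; rewrite dotDr dotZr.
- apply: (@cvgr_to_le _ U _ _ (fun i => `|dot (u i) y|)).
    by apply: cvg_norm; exact: Lcvg.
  apply: (@filterE _ U) => i.
  by rewrite (le_trans (normr_dot_le _ _))// ler_wpM2r.
by exists l => y; rewrite -lE.
Qed.

Lemma dot_cvg0 {T : Type} (F : set_system T) (u v : T -> X) (C : R) :
  Filter F -> (forall i, `|u i| <= C) -> v i @[i --> F] --> 0 ->
  dot (u i) (v i) @[i --> F] --> 0.
Proof.
move=> FF uC v0.
have Cv0 : C * `|v i| @[i --> F] --> 0.
  rewrite -(mulr0 C) -(normr0 X).
  by apply: cvgM; [exact: cvg_cst | exact: cvg_norm].
apply: (@squeeze_cvgr _ _ _ _ (fun i => - (C * `|v i|))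
  (fun i => C * `|v i|)) => //.
  apply: filterE => i; rewrite -ler_norml (le_trans (normr_dot_le _ _))//.
  by rewrite ler_wpM2r.
by rewrite -oppr0; exact: cvgN.
Qed.

(** * The splitting operator *)

Section Splitting.
Context {M : nat}.
Notation V := ('I_M -> X).
Context (omega : 'I_M -> R) (A : X -> set X) (B : 'I_M -> X -> set X) (eps : R).
Hypothesis omega_gt0 : forall m, 0 < omega m.
Hypothesis omega_sum : \sum_(m < M) omega m = 1.
Implicit Types (s t r a b : V).

Definition wdot s t : R := \sum_(m < M) omega m * dot (s m) (t m).

Lemma wdotC s t : wdot s t = wdot t s.
Proof. by apply: eq_bigr => m _; rewrite dotC. Qed.

Lemma wdotDl s t r : wdot (s + t) r = wdot s r + wdot t r.
Proof.
by rewrite /wdot -big_split; apply: eq_bigr => m _; rewrite fctE dotDl mulrDr.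
Qed.

Lemma wdotDr s t r : wdot r (s + t) = wdot r s + wdot r t.
Proof. by rewrite wdotC wdotDl !(wdotC r). Qed.

Lemma wdotZl (c : R) s r : wdot (c *: s) r = c * wdot s r.
Proof.
by rewrite /wdot mulr_sumr; apply: eq_bigr => m _; rewrite fctE dotZl mulrCA.
Qed.

Lemma wdotZr (c : R) s r : wdot r (c *: s) = c * wdot r s.
Proof. by rewrite wdotC wdotZl wdotC. Qed.

Lemma wdotNl s r : wdot (- s) r = - wdot s r.
Proof. by rewrite -scaleN1r wdotZl mulN1r. Qed.

Lemma wdotNr s r : wdot r (- s) = - wdot r s.
Proof. by rewrite wdotC wdotNl wdotC. Qed.

Definition wdotE := (wdotDl, wdotDr, wdotNl, wdotNr, wdotZl, wdotZr).

Lemma wdot_ge0 s : 0 <= wdot s s.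
Proof.
by apply: sumr_ge0 => m _; rewrite mulr_ge0 ?dot_norm ?sqr_ge0 1?ltW.
Qed.

Lemma coord_le_wdot s m : omega m * `|s m| ^+ 2 <= wdot s s.
Proof.
rewrite /wdot (bigD1 m)//= dot_norm lerDl sumr_ge0// => k _.
by rewrite mulr_ge0 ?dot_norm ?sqr_ge0 1?ltW.
Qed.

Lemma wdot_le0 s : wdot s s <= 0 -> forall m, s m = 0.
Proof.
move=> s0 m; have := le_trans (coord_le_wdot s m) s0.
by rewrite pmulr_rle0// exprn_even_le0//= normr_eq0 => /eqP.
Qed.

Definition monotone_op (T : X -> set X) :=
  forall x y u v, T x u -> T y v -> 0 <= dot (x - y) (u - v).

(** By Minty's theorem, this singles out the maximal operators among the monotone
ones. *)
Definition id_plus_onto (T : X -> set X) := forall x, exists p, T p (x - p).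

Hypothesis epsE : eps = 1 \/ eps = -1.
Hypotheses (A_mono : monotone_op A) (B_mono : forall m, monotone_op (B m)).

(** The graph of the Douglas-Rachford operator with residual [r] at [s] and shadow
point [x]. The resolvent of [A] is evaluated before those of the [B m] if
[eps = 1], and after them if [eps = -1]. *)
Definition dr_step s r x := exists (a : X) (b : V),
  [/\ A x a, forall m, B m (x + eps *: r m) (b m),
      forall m, s m = x - r m - eps *: b m
    & a + \sum_(m < M) omega m *: (b m + r m) = 0].

(** Write [dx], [dr], [da], [db] for the differences. Monotonicity of [B m] bounds
[- eps * dot (dr m) (db m)] by [dot dx (db m)], so that the left-hand side is at
most [dot dx] of the weighted sum of [db + dr]; that sum is [- da], and
monotonicity of [A] concludes. *)
Lemma dr_step_firm s r x s' r' x' : dr_step s r x -> dr_step s' r' x' ->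
  wdot (s - s') (r - r') + wdot (r - r') (r - r') <= 0.
Proof.
move=> [a [b [Aa Bb sE ab0]]] [a' [b' [Aa' Bb' sE' ab0']]].
apply: (@le_trans _ _
  (\sum_(m < M) dot (x - x') (omega m *: ((b m + r m) - (b' m + r' m))))).
  rewrite /wdot -big_split; apply: ler_sum => m _ /=.
  rewrite -mulrDr dotZr ler_pM2l// !fctE !sE !sE'.
  have := B_mono _ _ _ _ _ (Bb m) (Bb' m).
  have -> : x + eps *: r m - (x' + eps *: r' m)
      = (x - x') + eps *: (r m - r' m).
    by rewrite scalerBr opprD addrACA.
  have -> : x - r m - eps *: b m - (x' - r' m - eps *: b' m) =
            (x - x') - (r m - r' m) - eps *: (b m - b' m).
    by apply: dot_inj => w; rewrite !dotE; ring.
  have -> : b m + r m - (b' m + r' m) = (b m - b' m) + (r m - r' m).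
    by rewrite opprD addrACA.
  move: (x - x') (r m - r' m) (b m - b' m) => dx dr db.
  by case: epsE => ->; rewrite !dotE (dotC dr db); lra.
rewrite -dot_sumr.
under eq_bigr do rewrite scalerBr.
rewrite sumrB.
have -> : \sum_(m < M) omega m *: (b m + r m) = - a.
  by apply/eqP; rewrite -addr_eq0 addrC ab0.
have -> : \sum_(m < M) omega m *: (b' m + r' m) = - a'.
  by apply/eqP; rewrite -addr_eq0 addrC ab0'.
by rewrite -opprD dotNr oppr_le0; exact: A_mono.
Qed.

(** The resolvent evaluated first depends only on [s] and is nonexpansive: for
[eps = 1] its value is [x], for [eps = -1] its values are the [x - r m]. *)
Lemma dr_step_lipschitz s r x s' r' x' : dr_step s r x -> dr_step s' r' x' ->
  `|x - x'| <= \sum_(m < M) omega m * (`|s m - s' m| + `|r m - r' m|).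
Proof.
move=> [a [b [Aa Bb sE ab0]]] [a' [b' [Aa' Bb' sE' ab0']]].
have avgE y : y = \sum_(m < M) omega m *: y.
  by rewrite -scaler_suml omega_sum scale1r.
have [eps1|epsN1] := epsE.
- have ds_ge : `|x - x'| <= `|\sum_(m < M) omega m *: (s m - s' m)|.
    apply: le_norm_dot; have := A_mono _ _ _ _ Aa Aa'; congr (_ <= dot _ _).
    rewrite [in RHS](avgE (x - x')) -sumrB.
    have -> : a = - \sum_(m < M) omega m *: (b m + r m).
      by apply/eqP; rewrite -addr_eq0 ab0.
    have -> : a' = - \sum_(m < M) omega m *: (b' m + r' m).
      by apply/eqP; rewrite -addr_eq0 ab0'.
    rewrite -opprD -sumrB -sumrN; apply: eq_bigr => m _.
    by rewrite sE sE' eps1; apply: dot_inj => w; rewrite !dotE; ring.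
  apply: (le_trans ds_ge); apply: (le_trans (ler_norm_sum _ _ _)).
  apply: ler_sum => m _; rewrite normrZ (gtr0_norm (omega_gt0 m)).
  by rewrite ler_pM2l// lerDl.
- rewrite [in leLHS](avgE (x - x')).
  apply: (le_trans (ler_norm_sum _ _ _)).
  apply: ler_sum => m _; rewrite normrZ (gtr0_norm (omega_gt0 m)) ler_pM2l//.
  have := B_mono _ _ _ _ _ (Bb m) (Bb' m).
  have -> : x + eps *: r m - (x' + eps *: r' m) = (x - r m) - (x' - r' m).
    by rewrite epsN1 !scaleN1r.
  have -> : b m - b' m = (s m - s' m) - ((x - r m) - (x' - r' m)).
    by rewrite sE sE' epsN1; apply: dot_inj => w; rewrite !dotE; ring.
  move=> /le_norm_dot dz_le.
  have -> : x - x' = ((x - r m) - (x' - r' m)) + (r m - r' m).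
    by apply: dot_inj => w; rewrite !dotE; ring.
  by rewrite (le_trans (ler_normD _ _))// lerD2r.
Qed.

Hypotheses (A_full : id_plus_onto A) (B_full : forall m, id_plus_onto (B m)).

(** Set [b = eps * (x - s)] and [a = - sum omega * b], the only candidates, and let
[p], [q m] be the resolvents at [x + a], [x + b m]. Adding up the monotonicity
inequalities between the step [i] and these resolvents gives a nonnegative real
[h i], in which the products of two weakly convergent vectors cancel by the
balance equation. What remains passes to the limit, which turns out to be
[- |x - p|^2 - sum omega m * |x - q m|^2]. Hence [x = p = q m], so that [a] and
[b m] belong to [A x] and [B m x]. *)
Lemma dr_step_demiclosed {T : Type} (F : set_system T) (s_ r_ : T -> V)
    (x_ : T -> X) (C : 'I_M -> R) s x : ProperFilter F ->
  (forall i, dr_step (s_ i) (r_ i) (x_ i)) ->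
  (forall i m, `|s_ i m| <= C m) ->
  (forall m, r_ i m @[i --> F] --> 0) ->
  (forall m y, dot (s_ i m) y @[i --> F] --> dot (s m) y) ->
  (forall y, dot (x_ i) y @[i --> F] --> dot x y) ->
  dr_step s 0 x.
Proof.
move=> FF step sC r0 s_cvg x_cvg.
pose b m := eps *: (x - s m).
pose a := - \sum_(m < M) omega m *: b m.
have [p Ap] := A_full (x + a).
have /choice[q Bq] : forall m, exists q, B m q (x + b m - q).
  by move=> m; exact: B_full.
pose w := x + a - p; pose e m := x + b m - q m.
pose h i := dot (p - x_ i) w + \sum_(m < M) omega m *
  (dot (q m) (e m) + dot (x_ i) (eps *: (p - q m) - e m)
   - dot (s_ i m) (eps *: (p - q m))
   + dot (r_ i m) (p - eps *: (p - q m) - eps *: e m)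
   - dot (r_ i m) (r_ i m) - dot (s_ i m) (r_ i m)).
pose l := dot (p - x) w + \sum_(m < M) omega m *
  (dot (q m) (e m) + dot x (eps *: (p - q m) - e m)
   - dot (s m) (eps *: (p - q m)) + 0 - 0 - 0).
have h_ge0 i : 0 <= h i.
  have [ai [bi [Aa Bb sE ab0]]] := step i.
  have aE : ai = - \sum_(m < M) omega m *: (bi m + r_ i m).
    by apply/eqP; rewrite -addr_eq0 ab0.
  suff -> : h i = dot (x_ i - p) (ai - w) +
      \sum_(m < M) omega m * dot (x_ i + eps *: r_ i m - q m) (bi m - e m).
    rewrite addr_ge0 ?A_mono// sumr_ge0// => m _.
    by rewrite mulr_ge0 ?(ltW (omega_gt0 m))//; exact: B_mono.
  have -> : dot (x_ i - p) (ai - w) = dot (p - x_ i) w +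
      \sum_(m < M) omega m * dot (p - x_ i) (bi m + r_ i m).
    under eq_bigr do rewrite -dotZr.
    by rewrite -dot_sumr aE !dotE; ring.
  rewrite /h -addrA -big_split; congr (_ + _); apply: eq_bigr => m _ /=.
  rewrite -mulrDr; congr (_ * _).
  rewrite sE; move: (x_ i) (r_ i m) (bi m) (q m) (e m) => xi ri b' q' e'.
  (* ring does not know that dot is symmetric: each mixed product is written
     in one order. *)
  by case: epsE => ->; rewrite !dotE
    ?(dotC xi p) ?(dotC ri p) ?(dotC b' p) ?(dotC q' p) ?(dotC e' p)
    ?(dotC ri xi) ?(dotC b' xi) ?(dotC q' xi) ?(dotC e' xi)
    ?(dotC b' ri) ?(dotC q' ri) ?(dotC e' ri)
    ?(dotC q' b') ?(dotC e' b') ?(dotC e' q'); ring.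
have h_cvg : h i @[i --> F] --> l.
  apply: cvgD.
    have -> : (fun i => dot (p - x_ i) w) = (fun i => dot p w - dot (x_ i) w).
      by apply/funext => i; rewrite dotDl dotNl.
    by rewrite dotDl dotNl; apply: cvgB; [exact: cvg_cst | exact: x_cvg].
  apply: cvg_big => [|m _]; first exact: add_continuous.
  apply: cvgM; first exact: cvg_cst.
  apply: cvgB; last exact: dot_cvg0 (sC ^~ m) (r0 m).
  apply: cvgB; last first.
    have -> : (fun i => dot (r_ i m) (r_ i m)) =
        (fun i => `|r_ i m| * `|r_ i m|).
      by apply/funext => i; rewrite dot_norm expr2.
    rewrite -(mulr0 `|0 : X|) -[X in _ * X](normr0 X).
    by apply: cvgM; exact: cvg_norm.
  apply: cvgD; last first.
    set y := p - _ - _.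
    have -> : (fun i => dot (r_ i m) y) = (fun i => dot y (r_ i m)).
      by apply/funext => i; rewrite dotC.
    exact: (@dot_cvg0 _ _ (fun=> y) _ `|y|).
  apply: cvgB; last exact: s_cvg.
  by apply: cvgD; [exact: cvg_cst | exact: x_cvg].
have lE : l = - (`|x - p| ^+ 2 + \sum_(m < M) omega m * `|x - q m| ^+ 2).
  rewrite /l; have -> : dot (p - x) w = - `|x - p| ^+ 2 +
      \sum_(m < M) omega m * dot (x - p) (b m).
    under eq_bigr do rewrite -dotZr.
    rewrite -dot_sumr -dot_norm -[\sum_(m < M) _ *: _]opprK -/a /w !dotE.
    by rewrite (dotC p x); ring.
  rewrite opprD -addrA -big_split -sumrN; congr (_ + _).
  apply: eq_bigr => m _ /=; rewrite -mulrDr -mulrN -dot_norm; congr (_ * _).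
  rewrite /e /b; move: (s m) (q m) => s' q'.
  by case: epsE => ->; rewrite !dotE ?(dotC x p) ?(dotC s' p) ?(dotC q' p)
    ?(dotC s' x) ?(dotC q' x) ?(dotC q' s'); ring.
have : `|x - p| ^+ 2 + \sum_(m < M) omega m * `|x - q m| ^+ 2 <= 0.
  by rewrite -oppr_ge0 -lE (cvgr_to_ge h_cvg)//; exact: filterE.
have sq_ge0 m : 0 <= omega m * `|x - q m| ^+ 2.
  by rewrite mulr_ge0 ?sqr_ge0// ltW.
have sum_ge0 : 0 <= \sum_(m < M) omega m * `|x - q m| ^+ 2 by exact: sumr_ge0.
have sqp_ge0 : 0 <= `|x - p| ^+ 2 by rewrite sqr_ge0.
move=> l_le0.
have xp : x = p.
  by apply/eqP; rewrite -subr_eq0 -normr_eq0 -sqrf_eq0; lra.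
have xq m : x = q m.
  have /psumr_eq0P/(_ m isT)/eqP :
    \sum_(m < M) omega m * `|x - q m| ^+ 2 = 0 by lra.
  rewrite mulf_eq0 gt_eqF//= sqrf_eq0 normr_eq0 subr_eq0 => H.
  by apply/eqP/H.
exists a, b; split.
- by move: Ap; rewrite -xp addrAC subrr add0r.
- by move=> m; have := Bq m; rewrite -xq scaler0 addr0 addrAC subrr add0r.
- move=> m; rewrite /b.
  by case: epsE => ->; apply: dot_inj => v; rewrite !dotE; ring.
- apply/eqP; rewrite /a addrC subr_eq0; apply/eqP/eq_bigr => m _.
  by rewrite addr0.
Qed.

(** * The relaxed iteration *)

Section Iteration.
Context (rho : nat -> R) (s_ r_ : nat -> V) (x_ : nat -> X).
Hypothesis rho_02 : forall i, 0 <= rho i <= 2.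
Hypothesis rho_sum : (\sum_(0 <= i <oo) (rho i * (2 - rho i))%:E = +oo)%E.
Hypothesis step : forall i, dr_step (s_ i) (r_ i) (x_ i).
Hypothesis relax : forall i, s_ i.+1 = s_ i + rho i *: r_ i.

(** Firm nonexpansiveness between consecutive iterates, whose difference is
[rho i * r_ i]. For [rho i = 0] it forces the two residuals to coincide. *)
Lemma residual_nonincreasing i :
  wdot (r_ i.+1) (r_ i.+1) <= wdot (r_ i) (r_ i).
Proof.
have := dr_step_firm _ _ _ _ _ _ (step i.+1) (step i).
have -> : s_ i.+1 - s_ i = rho i *: r_ i by rewrite relax addrC addKr.
have /andP[rho0 rho2] := rho_02 i.
have [rho_gt0|rho_le0] := ltP 0 (rho i).
  have : 0 <= (2 - rho i) * wdot (r_ i.+1 - r_ i) (r_ i.+1 - r_ i).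
    by rewrite mulr_ge0 ?wdot_ge0// subr_ge0.
  rewrite !wdotE (wdotC (r_ i.+1) (r_ i)) => ge0 firm.
  by rewrite -subr_le0 -(pmulr_rle0 _ rho_gt0); lra.
have -> : rho i = 0 by lra.
rewrite wdotZl mul0r add0r => /wdot_le0 dr0.
suff -> : r_ i.+1 = r_ i by [].
by apply/funext => m; apply/eqP; rewrite -subr_eq0; apply/eqP; exact: dr0.
Qed.

Lemma fejer s x i : dr_step s 0 x ->
  wdot (s_ i.+1 - s) (s_ i.+1 - s) +
    rho i * (2 - rho i) * wdot (r_ i) (r_ i) <= wdot (s_ i - s) (s_ i - s).
Proof.
move=> /(dr_step_firm _ _ _ _ _ _ (step i)); rewrite subr0 => firm.
have -> : s_ i.+1 - s = (s_ i - s) + rho i *: r_ i by rewrite relax addrAC.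
have /andP[rho0 _] := rho_02 i.
move: firm; move: (s_ i - s) (r_ i) => d r; rewrite !wdotE (wdotC r d) => firm.
by have := ler_wpM2l rho0 firm; lra.
Qed.

(** Summing [fejer] and using that the squared residuals decrease, the n-th one
times the n-th partial sum of [rho * (2 - rho)] is bounded by the initial
squared distance to a fixed point. *)
Lemma residual_cvg0 s x : dr_step s 0 x ->
  wdot (r_ i) (r_ i) @[i --> \oo] --> 0.
Proof.
move=> fix_s.
pose D i := wdot (s_ i - s) (s_ i - s).
pose S n := \sum_(0 <= i < n) rho i * (2 - rho i).
have rho_ge0 i : 0 <= rho i * (2 - rho i).
  by have /andP[? ?] := rho_02 i; rewrite mulr_ge0// subr_ge0.
have sum_le n : S n * wdot (r_ n) (r_ n) + D n <= D 0%N.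
  elim: n => [|n IH]; first by rewrite /S big_geq// mul0r add0r.
  rewrite /S big_nat_recr//= -/(S n).
  have S0 : 0 <= S n by rewrite sumr_ge0.
  have := fejer _ _ n fix_s; rewrite -/(D n.+1) -/(D n).
  have := residual_nonincreasing n; have := rho_ge0 n.
  by nra.
apply/cvgrPdist_le => e e0.
(* Adding e to D 0 keeps the bound informative when D 0 = 0. *)
have /cvgeyPge/(_ ((D 0%N + e) / e)) : (fun n => (S n)%:E) @ \oo --> +oo%E.
  rewrite -rho_sum (_ : (fun n => _) =
    fun n => (\sum_(0 <= i < n) (rho i * (2 - rho i))%:E)%E).
    by apply: is_cvg_nneseries => i _ _; rewrite lee_fin.
  by apply/funext => n; rewrite sumEFin.
apply: filterS => n; rewrite lee_fin ler_pdivrMr// => leS.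
have W0 := wdot_ge0 (r_ n).
rewrite sub0r normrN ger0_norm//.
have Dn : 0 <= D n by exact: wdot_ge0.
have S0 : 0 <= S n by rewrite sumr_ge0.
by have := sum_le n; nra.
Qed.

Lemma fejer_cvg s x : dr_step s 0 x ->
  exists l : R, wdot (s_ i - s) (s_ i - s) @[i --> \oo] --> l.
Proof.
move=> fix_s; apply/cvg_ex/nonincreasing_is_cvgn.
  apply/nonincreasing_seqP => i; have := fejer _ _ i fix_s.
  have /andP[rho0 rho2] := rho_02 i.
  have : 0 <= rho i * (2 - rho i) * wdot (r_ i) (r_ i).
    by rewrite !mulr_ge0 ?wdot_ge0// subr_ge0.
  lra.
by exists 0 => _ [i _ <-]; exact: wdot_ge0.
Qed.

Lemma residual_coord_cvg0 s x m : dr_step s 0 x -> r_ i m @[i --> \oo] --> 0.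
Proof.
move=> fix_s; apply/cvgr0Pnorm_le => e e0.
have we : 0 < omega m * e ^+ 2 by rewrite mulr_gt0 ?exprn_gt0.
have /cvgr0Pnorm_le/(_ _ we) := residual_cvg0 _ _ fix_s.
apply: filterS => i; rewrite ger0_norm ?wdot_ge0// => le_w.
have := le_trans (coord_le_wdot (r_ i) m) le_w.
by rewrite ler_pM2l// ler_pXn2r ?nnegrE// ltW.
Qed.

Lemma coord_bounded (u : nat -> V) s (l : R) m :
  wdot (u i - s) (u i - s) @[i --> \oo] --> l ->
  exists C, forall i, `|u i m| <= C.
Proof.
move=> /cvgP/cvg_seq_bounded[K [_ /(_ (K + 1))]].
rewrite ltrDl => /(_ ltr01) uK.
exists ((K + 1) / omega m + 1 + `|s m|) => i.
have := uK i I => /=; rewrite ger0_norm ?wdot_ge0// => le_K.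
have := le_trans (coord_le_wdot (u i - s) m) le_K.
rewrite mulrC -ler_pdivlMr// => sq_le.
have : `|(u i - s) m| <= (K + 1) / omega m + 1.
  by have := sqr_ge0 (`|(u i - s) m| - 1); have := sqr_ge0 `|(u i - s) m|; lra.
rewrite -[u i m](subrK (s m)) => le_d.
by rewrite (le_trans (ler_normD _ _))// lerD2r.
Qed.

Lemma iterates_bounded s x : dr_step s 0 x ->
  exists (C : 'I_M -> R) (D : R),
    (forall i m, `|s_ i m| <= C m) /\ (forall i, `|x_ i| <= D).
Proof.
move=> fix_s; have [l sl] := fejer_cvg _ _ fix_s.
have /choice[C sC] : forall m, exists c, forall i, `|s_ i m| <= c.
  by move=> m; exact: coord_bounded sl.
have /choice[E rE] : forall m, exists c, forall i, `|r_ i m| <= c.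
  move=> m; apply: (@coord_bounded _ 0 0).
  have -> : (fun i => wdot (r_ i - 0) (r_ i - 0)) =
      (fun i => wdot (r_ i) (r_ i)).
    by apply/funext => i; rewrite subr0.
  exact: residual_cvg0 fix_s.
exists C, (`|x| + \sum_(m < M) omega m * (C m + `|s m| + E m)); split.
  by move=> i m; exact: sC.
move=> i; rewrite -[x_ i](subrK x) (le_trans (ler_normD _ _))// addrC lerD2l.
apply: (le_trans (dr_step_lipschitz _ _ _ _ _ _ (step i) fix_s)).
apply: ler_sum => m _; rewrite ler_pM2l// subr0 lerD//.
by rewrite (le_trans (ler_normB _ _))// lerD2r.
Qed.

Lemma wdot_weak_cvg (U : set_system nat) s t : Filter U ->
  (forall m y, dot (s_ i m) y @[i --> U] --> dot (s m) y) ->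
  wdot (s_ i) t @[i --> U] --> wdot s t.
Proof.
move=> UF s_cvg; apply: cvg_big => [|m _]; first exact: add_continuous.
by apply: cvgM; [exact: cvg_cst | exact: s_cvg].
Qed.

(** The squared distances from the iterates to [s] and to [s'] both converge, hence
so does their difference, which is affine in the iterate with linear part
[wdot (s_ i) (s - s')] up to a factor. The limits of that
linear part along [U] and [U'] agree, that is [wdot (s - s') (s - s') = 0]. *)
Lemma opial_unique s s' x x' (U U' : set_system nat) :
  ProperFilter U -> ProperFilter U' -> \oo `<=` U -> \oo `<=` U' ->
  dr_step s 0 x -> dr_step s' 0 x' ->
  (forall m y, dot (s_ i m) y @[i --> U] --> dot (s m) y) ->
  (forall m y, dot (s_ i m) y @[i --> U'] --> dot (s' m) y) ->
  s = s'.
Proof.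
move=> UF UF' oU oU' fix_s fix_s' sU sU'.
have [l sl] := fejer_cvg _ _ fix_s; have [l' sl'] := fejer_cvg _ _ fix_s'.
(* The limit of wdot (s_ i) (s - s'), by polarization. *)
pose c := 2^-1 * (l' - l + wdot s s - wdot s' s').
have sd_cvg : wdot (s_ i) (s - s') @[i --> \oo] --> c.
  have -> : (fun i => wdot (s_ i) (s - s')) =
      (fun i => 2^-1 * (wdot (s_ i - s') (s_ i - s')
        - wdot (s_ i - s) (s_ i - s) + wdot s s - wdot s' s')).
    apply/funext => i; rewrite !wdotE (wdotC s (s_ i)) (wdotC s' (s_ i)).
    by field.
  apply: cvgM; first exact: cvg_cst.
  by do 2![apply: cvgD; last exact: cvg_cst]; apply: cvgB.
have lim_eq (G : set_system nat) t : ProperFilter G -> \oo `<=` G ->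
    (forall m y, dot (s_ i m) y @[i --> G] --> dot (t m) y) ->
    wdot t (s - s') = c.
  move=> GF oG tG; apply: cvg_unique (wdot_weak_cvg _ _ (s - s') _ tG) _ => //.
  by move=> N /sd_cvg; exact: oG.
have := lim_eq _ _ UF oU sU; rewrite -(lim_eq _ _ UF' oU' sU') => /eqP.
rewrite -subr_eq0 -wdotNl -wdotDl => /eqP ss'.
have /wdot_le0 d0 : wdot (s - s') (s - s') <= 0 by rewrite ss'.
by apply/funext => m; apply/eqP; rewrite -subr_eq0; apply/eqP; exact: d0.
Qed.

Theorem dr_weak_cvg : (exists s x, dr_step s 0 x) ->
  exists2 x, exists s, dr_step s 0 x & weakly_cvg_to dot x_ x.
Proof.
move=> [s0 [x0 fix0]].
have [C [D [sC xD]]] := iterates_bounded _ _ fix0.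
have cluster (U : set_system nat) : UltraFilter U -> \oo `<=` U -> exists s x,
    [/\ dr_step s 0 x,
        forall m y, dot (s_ i m) y @[i --> U] --> dot (s m) y
      & forall y, dot (x_ i) y @[i --> U] --> dot x y].
  move=> UU oU.
  have /choice[s sU] : forall m, exists l, forall y,
      dot (s_ i m) y @[i --> U] --> dot l y.
    by move=> m; exact: ultra_weak_limit (sC ^~ m).
  have [x xU] := ultra_weak_limit _ _ _ UU xD.
  exists s, x; split=> //.
  apply: dr_step_demiclosed step sC _ sU xU => m.
  by move=> N /(residual_coord_cvg0 _ _ m fix0); exact: oU.
have [U [UU oU]] := ultraFilterLemma (eventually_filter : ProperFilter \oo).
have [s [x [fix_s sU xU]]] := cluster U UU oU.
exists x; first by exists s.
move=> y; apply: ultra_cvg => U' UU' oU'.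
have [s' [x' [fix_s' sU' xU']]] := cluster U' UU' oU'.
have ss' : s = s' by exact: opial_unique fix_s fix_s' sU sU'.
suff -> : x = x' by exact: xU'.
have := dr_step_lipschitz _ _ _ _ _ _ fix_s fix_s'.
rewrite big1 => [|m _]; last by rewrite ss' !subrr normr0 addr0 mulr0.
by rewrite normr_le0 subr_eq0 => /eqP.
Qed.

End Iteration.

End Splitting.

End HilbertSpace.

(** * Both forms of the algorithm *)

Theorem theorem9p1 (R : realType) (X : completeNormedModType R)
  (dot : {dot X for idfun})
  (dot_norm : forall x : X, dot x x = `|x| ^+ 2)
  (M : nat) (M_ge1 : (1 <= M)%N)
  (f : X -> \bar R) (g : 'I_M -> X -> \bar R)
  (f_Gamma0 : Gamma0 f) (g_Gamma0 : forall m, Gamma0 (g m))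
  (inclusion : exists (x u : X) (v : 'I_M -> X),
     [/\ subdifferential dot f x u,
         forall m, subdifferential dot (g m) x (v m)
       & 0 = u + \sum_(m < M) v m])
  (tau : R) (tau_gt0 : 0 < tau)
  (omega : 'I_M -> R) (omega_gt0 : forall m, 0 < omega m)
  (omega_sum : \sum_(m < M) omega m = 1)
  (rho : nat -> R) (rho_02 : forall i, 0 <= rho i <= 2)
  (rho_sum : (\sum_(0 <= i <oo) (rho i * (2 - rho i))%:E = +oo)%E)
  (s : nat -> 'I_M -> X) (x : nat -> X)
  (iter : form_I f g tau omega rho s x \/
          exists xm : nat -> 'I_M -> X, form_II f g tau omega rho s xm x) :
  exists2 xsol : X,
    argmin (fun y => f y + \sum_(m < M) g m y)%E xsol
    & weakly_cvg_to dot x xsol.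
Proof.
pose A := subdifferential dot (fun y => tau%:E * f y)%E.
pose B m := subdifferential dot (fun y => (tau / omega m)%:E * g m y)%E.
have tw_gt0 m : 0 < tau / omega m by rewrite divr_gt0.
have f_scaled := Gamma0_scale _ _ tau_gt0 f_Gamma0.
have g_scaled m := Gamma0_scale _ _ (tw_gt0 m) (g_Gamma0 m).
pose proxf := prox (fun y => tau%:E * f y)%E.
pose proxg m := prox (fun y => (tau / omega m)%:E * g m y)%E.
have proxA y : A (proxf y) (y - proxf y) by exact: prox_subdifferential.
have proxB m y : B m (proxg m y) (y - proxg m y).
  exact: prox_subdifferential.
have A_full : id_plus_onto A by move=> y; exists (proxf y).
have B_full m : id_plus_onto (B m) by move=> y; exists (proxg m y).
have A_mono : monotone_op dot A.
  by case: f_scaled => _ fP _ y z u v; exact: subdifferential_monotone.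
have B_mono m : monotone_op dot (B m).
  by case: (g_scaled m) => _ gP _ y z u v; exact: subdifferential_monotone.
(* The factors omega m in the step sizes compensate the weights of the sums. *)
have weightedE (v : 'I_M -> X) :
    \sum_(m < M) omega m *: ((tau / omega m) *: v m) = tau *: \sum_(m < M) v m.
  rewrite scaler_sumr; apply: eq_bigr => m _.
  by rewrite scalerA mulrC divfK// gt_eqF.
have fixed eps : exists t y, dr_step omega A B eps t 0 y.
  have [y [u [v [fu gv uv0]]]] := inclusion.
  exists (fun m => y - 0 - eps *: ((tau / omega m) *: v m)), y.
  exists (tau *: u), (fun m => (tau / omega m) *: v m); split=> //.
  - exact/subdifferential_scale.
  - by move=> m; rewrite scaler0 addr0; exact/subdifferential_scale.
  - under eq_bigr do rewrite addr0.
    by rewrite weightedE -scalerDr -uv0 scaler0.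
have solution eps t y : dr_step omega A B eps t 0 y ->
    argmin (fun y => f y + \sum_(m < M) g m y)%E y.
  move=> [a [b [Aa Bb _ ab0]]].
  pose u := tau^-1 *: a; pose v m := (tau / omega m)^-1 *: b m.
  have aE : a = tau *: u by rewrite scalerA divff ?scale1r// gt_eqF.
  have bE m : b m = (tau / omega m) *: v m.
    by rewrite scalerA divff ?scale1r// gt_eqF.
  apply: (@argmin_sum _ _ dot _ f g y u v).
  - by case: f_Gamma0.
  - by move=> m; case: (g_Gamma0 m).
  - by apply/(subdifferential_scale _ _ tau); rewrite -?aE.
  - move=> m; apply/(subdifferential_scale _ _ (tau / omega m)) => //.
    by rewrite -bE; have := Bb m; rewrite scaler0 addr0.
  - move: ab0; under eq_bigr do rewrite addr0 bE.
    rewrite weightedE aE -scalerDr => /eqP.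
    by rewrite scaler_eq0 gt_eqF//= => /eqP.
suff [eps [r [eps1 step relax]]] : exists eps (r : nat -> 'I_M -> X),
    [/\ eps = 1 \/ eps = -1,
        forall i, dr_step omega A B eps (s i) (r i) (x i)
      & forall i, s i.+1 = s i + rho i *: r i].
  have [xsol [t fix_t] x_cvg] := dr_weak_cvg dot dot_norm omega A B eps
    omega_gt0 omega_sum eps1 A_mono B_mono A_full B_full
    rho s r x rho_02 rho_sum step relax (fixed eps).
  by exists xsol => //; exact: solution fix_t.
have avgE (y : X) : y = \sum_(m < M) omega m *: y.
  by rewrite -scaler_suml omega_sum scale1r.
(* In both forms, a and b are the subgradients y - prox y that the proximity
   operators exhibit at their arguments y. *)
case: iter => [formI|[xm formII]].
- pose z i m := proxg m (2 *: x i - s i m).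
  exists 1, (fun i m => z i m - x i); split; first by left.
  + move=> i; have [xE _] := formI i.
    exists (\sum_(m < M) omega m *: s i m - x i).
    exists (fun m => (2 *: x i - s i m) - z i m).
    split.
    * by rewrite [x i]xE.
    * by move=> m; rewrite scale1r addrC subrK; exact: proxB.
    * move=> m; apply: (dot_inj dot dot_norm) => w.
      by rewrite !(dotE dot); ring.
    * rewrite [in X in _ - X](avgE (x i)) -sumrB -big_split.
      apply: big1 => m _; apply: (dot_inj dot dot_norm) => w /=.
      by rewrite !(dotE dot); ring.
  + by move=> i; apply/funext => m; have [_ ->] := formI i.
- exists (-1), (fun i m => x i - xm i m); split; first by right.
  + move=> i; have [xmE xE _] := formII i.
    exists (\sum_(m < M) omega m *: (2 *: xm i m - s i m) - x i).
    exists (fun m => s i m - xm i m).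
    split.
    * by rewrite [x i]xE.
    * by move=> m; rewrite scaleN1r opprB addrC subrK xmE; exact: proxB.
    * move=> m; apply: (dot_inj dot dot_norm) => w.
      by rewrite !(dotE dot); ring.
    * rewrite [in X in _ - X](avgE (x i)) -sumrB -big_split.
      apply: big1 => m _; apply: (dot_inj dot dot_norm) => w /=.
      by rewrite !(dotE dot); ring.
  + by move=> i; apply/funext => m; have [_ _ ->] := formII i.
Qed.
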